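(* Let $\Lambda\subset\mathbb{R}$ be open and let $$\mathcal{P}(2)=g_{0,1}(x)\,\mathrm{D}_{0,1}+g_{1,1}(x)\,\mathrm{D}_{1,1}+g_{2,1}(x)\,\mathrm{D}_{2,1},\qquad g_{k,h}\in\mathcal{C}(\Lambda,\mathbb{R}).$$ A necessary and sufficient condition for $\mathcal{P}(2)$ to be decomposed into the form $$\mathcal{P}(2)=\big[b_{1,0,1}(x)\,\mathrm{D}_{0,1}+b_{1,1,1}(x)\,\mathrm{D}_{1,1}\big]\big[b_{2,0,1}(x)\,\mathrm{D}_{0,1}+b_{2,1,1}(x)\,\mathrm{D}_{1,1}\big],$$ with $b_{1,0,1},b_{1,1,1}\in\mathcal{C}(\Lambda,\mathbb{R})$ and $b_{2,0,1},b_{2,1,1}\in\mathcal{C}^1(\Lambda,\mathbb{R})$, is that these functions satisfy on $\Lambda$ \begin{align*} g_{2,1}&=b_{1,1,1}b_{2,1,1},\\ g_{1,1}&=b_{1,0,1}b_{2,1,1}+b_{1,1,1}b_{2,0,1}+b_{1,1,1}\mathrm{D}_{1,1}(b_{2,1,1}),\\ g_{0,1}&=b_{1,0,1}b_{2,0,1}+b_{1,1,1}\mathrm{D}_{1,1}(b_{2,0,1}). \end{align*}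
   Context: Here $\mathrm{D}_{0,1}u=u$, $\mathrm{D}_{1,1}u=u_x=\frac{du}{dx}$, $\mathrm{D}_{2,1}u=u_{2x}=\frac{d^2u}{dx^2}$. The product of two bracketed operators is their composition (the right factor acts first). Equality of operators means that both sides give the same result on every $u\in\mathcal{C}^2(\Lambda_0,\mathbb{R})$, for open $\Lambda_0\subset\Lambda$. *)

(* Defs.v *)
From mathcomp Require Import all_boot all_order all_algebra.
From mathcomp Require Import all_classical all_reals all_analysis.

Set Implicit Arguments.
Unset Strict Implicit.
Unset Printing Implicit Defensive.

Import Order.TTheory GRing.Theory Num.Theory.
Import numFieldNormedType.Exports.

Local Open Scope classical_set_scope.
Local Open Scope ring_scope.

(* Functions on an open set A are represented by total functions R -> R; as A
   is open, continuity and derivatives at the points of A depend only on the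
   values taken on A.  Cclass k A is meant for open A only. *)
Definition Cclass (R : realType) (k : nat) (A : set R) (f : R -> R) : Prop :=
  (forall j : nat, (j < k)%N ->
     forall x : R, A x -> derivable (derive1n j f) x 1) /\
  (forall j : nat, (j <= k)%N ->
     forall x : R, A x -> {for x, continuous (derive1n j f)}).

Definition diffop1 (R : realType) (b0 b1 : R -> R) (u : R -> R) : R -> R :=
  fun x => b0 x * derive1n 0 u x + b1 x * derive1n 1 u x.

Definition diffop2 (R : realType) (g0 g1 g2 : R -> R) (u : R -> R) : R -> R :=
  fun x => g0 x * derive1n 0 u x + g1 x * derive1n 1 u x
           + g2 x * derive1n 2 u x.

(* u ranges over C^2(L0, R) for all open subsets L0 of L, not only over
   C^2(L, R), and the results are compared on L0. *)
Definition op_eq2 (R : realType) (L : set R)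
    (P Q : (R -> R) -> (R -> R)) : Prop :=
  forall L0 : set R, open L0 -> L0 `<=` L ->
  forall u : R -> R, Cclass 2 L0 u ->
  forall x : R, L0 x -> P u x = Q u x.

(* Main.v *)
Require Import Defs.
From mathcomp Require Import all_boot all_order all_algebra.
From mathcomp Require Import all_classical all_reals all_analysis.
From mathcomp Require Import ring.

Import Order.TTheory GRing.Theory Num.Theory.
Import numFieldNormedType.Exports.

Local Open Scope classical_set_scope.
Local Open Scope ring_scope.

(** The equivalence is a comparison of coefficients. By the product rule,
    [diffop1_comp], the composite of two first order operators is the second
    order operator whose coefficients are the right-hand sides of the three
    equations; so these equations suffice. Conversely, a second order operator
    is determined at each point by its values on functions defined near that
    point, because the triple [(u x, u' x, u'' x)] can be prescribed freely:
    the polynomials [1], ['X - x] and [('X - x) ^+ 2] give [(1, 0, 0)],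
    [(0, 1, 0)] and [(0, 0, 2)]. This is [diffop2_coef_unique]. *)

Lemma derive1n_horner (R : realType) (p : {poly R}) (n : nat) :
  derive1n n (horner p) = horner p^`(n).
Proof.
elim: n => [|n IH]; first by rewrite derive1n0 derivn0.
by rewrite derive1nS IH derivnS; apply/funext => x; rewrite derivE derive1E.
Qed.

Lemma Cclass_horner (R : realType) (k : nat) (A : set R) (p : {poly R}) :
  Cclass k A (horner p).
Proof.
split=> j _ x _; rewrite derive1n_horner; first exact: derivable_horner.
exact: continuous_horner.
Qed.

(** The product rule at [x]: differentiating [b20 * u + b21 * u'] also hits the
    coefficients of the inner operator, which contributes [b20'] to the term
    of order 0 and [b21'] to that of order 1. *)
Lemma diffop1_comp (R : realType) (b10 b11 b20 b21 u : R -> R) (x : R) :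
  derivable b20 x 1 -> derivable b21 x 1 ->
  derivable u x 1 -> derivable (derive1n 1 u) x 1 ->
  diffop1 b10 b11 (diffop1 b20 b21 u) x =
  diffop2 (fun x => b10 x * b20 x + b11 x * derive1n 1 b20 x)
    (fun x => b10 x * b21 x + b11 x * b20 x + b11 x * derive1n 1 b21 x)
    (fun x => b11 x * b21 x) u x.
Proof.
move=> db20 db21 du du'.
have diffop1E : diffop1 b20 b21 u = b20 * u + b21 * derive1n 1 u by [].
have derive_diffop1 : derive1n 1 (diffop1 b20 b21 u) x =
    b20 x * derive1n 1 u x + u x * derive1n 1 b20 x
    + (b21 x * derive1n 2 u x + derive1n 1 u x * derive1n 1 b21 x).
  rewrite diffop1E [derive1n 2 u]derive1nS !derive1n1 !derive1E.
  rewrite deriveD ?deriveM //; [|exact: derivableM..].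
  by rewrite derive1E.
rewrite -[LHS]/(b10 x * diffop1 b20 b21 u x
                + b11 x * derive1n 1 (diffop1 b20 b21 u) x) derive_diffop1.
by rewrite /diffop1 /diffop2 !derive1n0; ring.
Qed.

(** Testing on ['X - x] and its powers makes the system for the coefficients
    at [x] diagonal: among [u x], [u' x] and [u'' x] only one is nonzero
    for each test function [u]. *)
Lemma diffop2_coef_unique (R : realType) (g0 g1 g2 h0 h1 h2 : R -> R) (x : R) :
  (forall p : {poly R},
     diffop2 g0 g1 g2 (horner p) x = diffop2 h0 h1 h2 (horner p) x) ->
  [/\ g2 x = h2 x, g1 x = h1 x & g0 x = h0 x].
Proof.
move=> gh.
have diffE g g' g'' p : diffop2 g g' g'' (horner p) x =
    g x * p.[x] + g' x * p^`().[x] + g'' x * p^`()^`().[x].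
  by rewrite /diffop2 !derive1n_horner.
have := gh (('X - x%:P) ^+ 2); have := gh ('X - x%:P); have := gh 1.
rewrite !diffE !poly.derivE !hornerE /= => g0h0 g1h1 g2h2; split=> //.
- have neq2 : 1 + 1 != 0 :> R by rewrite (pnatr_eq0 R 2).
  move: g2h2; rewrite addrK !subrr !(mulr0, mul0r, add0r, addr0).
  exact: (mulIf neq2).
- by move: g1h1; rewrite subrr !mulr0 !add0r.
Qed.

Theorem proposition2p2 (R : realType) (L : set R) (openL : open L)
    (g0 g1 g2 : R -> R)
    (Cg0 : Cclass 0 L g0) (Cg1 : Cclass 0 L g1) (Cg2 : Cclass 0 L g2)
    (b10 b11 b20 b21 : R -> R)
    (Cb10 : Cclass 0 L b10) (Cb11 : Cclass 0 L b11)
    (Cb20 : Cclass 1 L b20) (Cb21 : Cclass 1 L b21) :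
  op_eq2 L (diffop2 g0 g1 g2) (diffop1 b10 b11 \o diffop1 b20 b21) <->
  (forall x : R, L x ->
    [/\ g2 x = b11 x * b21 x,
        g1 x = b10 x * b21 x + b11 x * b20 x + b11 x * derive1n 1 b21 x
      & g0 x = b10 x * b20 x + b11 x * derive1n 1 b20 x]).
Proof.
pose h0 x := b10 x * b20 x + b11 x * derive1n 1 b20 x.
pose h1 x := b10 x * b21 x + b11 x * b20 x + b11 x * derive1n 1 b21 x.
pose h2 x := b11 x * b21 x.
have compE L0 u x : L0 `<=` L -> Cclass 2 L0 u -> L0 x ->
    (diffop1 b10 b11 \o diffop1 b20 b21) u x = diffop2 h0 h1 h2 u x.
  move=> L0L [du _] L0x; have Lx := L0L _ L0x.
  apply: diffop1_comp; [exact: Cb20.1 0%N isT _ Lx | exact: Cb21.1 0%N isT _ Lx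
    | exact: du 0%N isT _ L0x | exact: du 1%N isT _ L0x].
split=> [eqL x Lx | coefE L0 _ L0L u Cu x L0x].
  (* Polynomials are of class C^2 everywhere, so [L] itself serves as [L0]. *)
  apply: (diffop2_coef_unique R g0 g1 g2 h0 h1 h2) => p.
  have Cp := Cclass_horner R 2 L p.
  by rewrite (eqL L openL (@subset_refl _ L) _ Cp _ Lx) (compE L).
by rewrite (compE L0) // /diffop2; case: (coefE x (L0L _ L0x)) => -> -> ->.
Qed.
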